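(* Let $\Gamma$ be a finite simple graph and $\sigma\in SEP(\Gamma)$. Then every disjoint cycle in the cycle decomposition of $\sigma$ belongs to $SEP(\Gamma)$, and for every cycle $c$ of $\sigma$, every cycle $\tau$ whose support is a proper subset of the support of $c$ (a proper sub-cycle of $c$; e.g. for $c=(1\,2\,3)$ these include $(1\,2),(1\,3),(2\,3)$) belongs to $SEP(\Gamma)$.
   Context: Two vertices $u,v$ of a graph $\Gamma$ are structurally equivalent if the transposition $(u\,v)$ (swapping $u,v$ and fixing all other vertices) is an automorphism of $\Gamma$. The structural equivalence permutation group is $SEP(\Gamma)=\langle\{(u\,v) : (u\,v)\in \mathrm{Aut}(\Gamma)\}\rangle$, a group of permutations of $V(\Gamma)$. *)

(* Defs.v *)
From mathcomp Require Import all_boot all_fingroup.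

Set Implicit Arguments.
Unset Strict Implicit.
Unset Printing Implicit Defensive.

Local Open Scope group_scope.

Definition graph_aut (T : finType) (e : rel T) : {set {perm T}} :=
  [set s : {perm T} | [forall x, forall y, e (s x) (s y) == e x y]].

Definition structurally_equivalent (T : finType) (e : rel T) (u v : T) : bool :=
  tperm u v \in graph_aut e.

(* [tperm u u] is the identity, which is not a transposition: hence [u != v]. *)
Definition SEP (T : finType) (e : rel T) : {set {perm T}} :=
  <<[set tperm u v | u in T, v in T
       & (u != v) && structurally_equivalent e u v]>>.

Definition psupp (T : finType) (s : {perm T}) : {set T} :=
  [set x | s x != x].

(* The cycle (x_1 x_2 ... x_k) with k >= 2; [next xs] fixes every point that
   is not in [xs]. *)
Definition is_cycle (T : finType) (c : {perm T}) : Prop :=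
  exists xs : seq T, [/\ uniq xs, 1 < size xs & c =1 next xs].

(* Fixed points do not contribute any factor. *)
Definition cycle_decomposition (T : finType) (s : {perm T})
    (cs : seq {perm T}) : Prop :=
  [/\ forall c, c \in cs -> is_cycle c,
      pairwise (fun c d => [disjoint psupp c & psupp d]) cs
    & s = \prod_(c <- cs) c].

Lemma prod_disjoint (T : finType) (cs : seq {perm T}) (x : T) :
  pairwise (fun c d => [disjoint psupp c & psupp d]) cs ->
  (forall c, c \in cs -> x \in psupp c -> (\prod_(c <- cs) c) x = c x) /\
  ((forall c, c \in cs -> x \notin psupp c) -> (\prod_(c <- cs) c) x = x).
Proof.
elim: cs x => [|d cs IHcs] x /=.
  by move=> _; split=> // _; rewrite big_nil perm1.
case/andP=> /allP d_cs cs_dis; rewrite big_cons permM.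
split=> [c | x_fix].
  rewrite inE => /predU1P[-> | c_cs] xc.
    have [_ fixP] := IHcs (d x) cs_dis.
    apply: fixP => c' /d_cs dis; apply: contraL dis => c'_dx.
    apply/pred0Pn; exists (d x); rewrite /= c'_dx andbT.
    by move: xc; rewrite !inE (inj_eq perm_inj).
  have := disjointFl (d_cs _ c_cs) xc; rewrite inE => /negbFE/eqP->.
  by have [memP _] := IHcs x cs_dis; apply: memP.
have: x \notin psupp d by apply: x_fix; rewrite mem_head.
rewrite inE negbK => /eqP->; have [_ fixP] := IHcs x cs_dis.
by apply: fixP => c c_cs; apply: x_fix; rewrite inE c_cs orbT.
Qed.

Lemma cycle_decomposition_exists (T : finType) (s : {perm T}) :
  exists cs, cycle_decomposition s cs.
Proof.
have sN x : s \in 'N(porbit s x | 'P).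
  by apply/astabsP => y /=; rewrite /aperm -!eq_porbit_mem (porbit_perm s 1).
pose os := [seq X : {set T} <- enum (porbits s) | 1 < #|X|].
have osP (X : {set T}) : X \in os -> exists2 x, X = porbit s x & 1 < #|X|.
  by rewrite mem_filter mem_enum => /andP[X1 /imsetP[x _ eX]]; exists x.
have sub X : psupp (restr_perm X s) \subset X.
  apply/subsetP=> y; rewrite inE; apply: contraR => yX.
  by rewrite (out_perm (restr_perm_on _ _)).
pose cs := [seq restr_perm X s | X : {set T} <- os].
have dis : pairwise (fun c d => [disjoint psupp c & psupp d]) cs.
  rewrite pairwise_map; apply/(pairwiseP set0) => i j i_os j_os ij /=.
  have u_os : uniq os by rewrite filter_uniq ?enum_uniq.
  apply: disjointWl (sub _) _; apply: disjointWr (sub _) _.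
  have [x eX _] := osP _ (mem_nth set0 i_os).
  have [y eY _] := osP _ (mem_nth set0 j_os).
  apply/pred0P=> z /=; apply/negP=> /andP[].
  have: nth set0 os i != nth set0 os j by rewrite nth_uniq // ltn_eqF.
  by rewrite eX eY -!eq_porbit_mem => + /eqP-> => /negP.
exists cs; split=> //.
  move=> _ /mapP[X /osP[x -> X1] ->].
  exists (traject s x #|porbit s x|).
  split; rewrite ?size_traject ?uniq_traject_porbit // => y.
  have [yX | yX] := boolP (y \in porbit s x); last first.
    rewrite (out_perm (restr_perm_on _ _)) //.
    by rewrite porbit_traject in yX; rewrite next_nth (negPf yX).
  rewrite restr_permE //; apply/eqP.
  apply: (@next_cycle _ (frel s)); last by rewrite -porbit_traject.
  have := iter_porbit s x; case: #|_| X1 => //= n _ e_iter.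
  rewrite rcons_path fpath_traject /= last_traject.
  exact/eqP.
apply/permP=> x; have [in_cs out_cs] := prod_disjoint x dis.
have [sx | sx] := eqVneq (s x) x.
  rewrite out_cs // => _ /mapP[X /osP[y -> _] ->]; rewrite inE negbK.
  have [xX | xX] := boolP (x \in porbit s y); last first.
    by rewrite (out_perm (restr_perm_on _ _)).
  by rewrite restr_permE ?sx.
have rx : restr_perm (porbit s x) s x = s x.
  by rewrite restr_permE ?porbit_id.
rewrite (in_cs (restr_perm (porbit s x) s)) ?rx ?inE ?rx //.
apply: map_f; rewrite mem_filter mem_enum imset_f // andbT.
apply/card_gt1P; exists x, (s x); rewrite porbit_id eq_sym sx.
by rewrite (mem_porbit s 1).
Qed.

(* Main.v *)
Require Import Defs.
From mathcomp Require Import all_boot all_fingroup.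

(** The relation [tperm x y \in SEP e] is an equivalence, by conjugation of
    transpositions, and a permutation lies in [SEP e] iff it maps every point
    to an equivalent one: each such permutation is sorted into the identity by
    transpositions of equivalent points.  A cycle of [s] moves points as [s]
    does, hence lies in [SEP e]; so do its powers, hence its whole support is
    in one class, on which every permutation is allowed. *)

Set Implicit Arguments.
Unset Strict Implicit.
Unset Printing Implicit Defensive.

Local Open Scope group_scope.

Section Transpositions.

Variables (T : finType) (G : {group {perm T}}).

Lemma tperm_group_trans (x y z : T) :
  tperm x y \in G -> tperm y z \in G -> tperm x z \in G.
Proof.
move=> Gxy Gyz; have [<- // | zx] := eqVneq x z; first by rewrite tperm1 group1.
have [<- // | yx] := eqVneq y x.
have <- : tperm x y ^ tperm y z = tperm x z.
  by rewrite tpermJ tpermL (tpermD yx) // eq_sym.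
exact: groupJ.
Qed.

(** Makes the pointwise condition a subgroup, so that it need only be checked on generators. Closure
    under products is [tperm_group_trans] along [x], [s x], [t (s x)]. *)
Lemma tperm_image_group_set :
  group_set [set s : {perm T} | [forall x, tperm x (s x) \in G]].
Proof.
apply/group_setP; split=> [|s t]; rewrite ?inE.
  by apply/forallP=> x; rewrite perm1 tperm1 group1.
move=> /forallP Gs /forallP Gt; apply/forallP=> x; rewrite permM.
exact: tperm_group_trans (Gs x) (Gt _).
Qed.

(** Induction on the size of the support: if [t] moves [x], then [t * tperm x (t x)] fixes [x] and
    every fixed point of [t]. *)
Lemma mem_tperm_image (t : {perm T}) :
  (forall x, tperm x (t x) \in G) -> t \in G.
Proof.
have [n] := ubnP #|psupp t|; elim: n t => // n IHn t t_n Gt.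
have [t_fix | [x]] := set_0Vmem (psupp t).
  suff -> : t = 1 by exact: group1.
  apply/permP=> x; rewrite perm1; apply/eqP.
  by move/setP/(_ x): t_fix; rewrite !inE => /negbFE.
rewrite inE => tx; rewrite -(groupMr t (Gt x)).
apply: IHn => [|y].
  rewrite -ltnS; apply: leq_trans t_n; rewrite ltnS; apply/proper_card/properP.
  split; last by exists x; rewrite !inE ?tx // permM tpermR eqxx.
  apply/subsetP=> y; rewrite !inE permM; apply: contra => /eqP ty.
  (* A fixed point [y] of [t] differs from [x], and from [t x] by injectivity. *)
  rewrite ty tpermD //; apply: contra_neq tx => txy; first by rewrite txy.
  by apply: (@perm_inj _ t); rewrite txy ty.
rewrite permM; apply: tperm_group_trans (Gt y) _.
have [-> | -> | _ _] := tpermP; rewrite ?tperm1 ?group1 //.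
by rewrite tpermC.
Qed.

End Transpositions.

Lemma mem_SEP (T : finType) (e : rel T) (s : {perm T}) :
  reflect (forall x, tperm x (s x) \in SEP e) (s \in SEP e).
Proof.
apply: (iffP idP) => [s_SEP x | ]; last exact: mem_tperm_image.
pose H := Group (tperm_image_group_set [group of SEP e]).
suff /subsetP/(_ s s_SEP) : SEP e \subset H by rewrite inE => /forallP.
rewrite gen_subG; apply/subsetP=> _ /imset2P[u v _ uvP ->].
have Guv : tperm u v \in SEP e by apply/mem_gen/imset2P; exists u v.
rewrite inE; apply/forallP=> y.
by have [-> | -> | _ _] := tpermP; rewrite ?tperm1 ?group1 // tpermC.
Qed.

(** [next xs] fixes all points outside [xs], so the support lies in [xs], which is a single
    orbit. *)
Lemma is_cycle_transitive (T : finType) (c : {perm T}) (x y : T) :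
  is_cycle c -> x \in psupp c -> y \in psupp c -> y \in porbit c x.
Proof.
case=> xs [xs_uniq _ cE].
have suppP z : z \in psupp c -> z \in xs.
  by rewrite inE cE next_nth; case: ifP => //; rewrite eqxx.
have c_xs : fcycle c xs.
  by rewrite (eq_fcycle cE); apply: cycle_next.
move=> /suppP x_xs /suppP; rewrite -(fconnect_cycle c_xs x_xs).
by move/iter_findex <-; rewrite -permX mem_porbit.
Qed.

Theorem theorem2p4 (T : finType) (e : rel T)
    (e_sym : symmetric e) (e_irr : irreflexive e)
    (s : {perm T}) (s_SEP : s \in SEP e)
    (cs : seq {perm T}) (cs_s : cycle_decomposition s cs) :
  (forall c : {perm T}, c \in cs -> c \in SEP e) /\
  (forall c : {perm T}, c \in cs ->
     forall t : {perm T}, is_cycle t -> psupp t \proper psupp c -> t \in SEP e).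
Proof.
case: cs_s => cs_cycle cs_dis s_prod.
have cs_SEP c : c \in cs -> c \in SEP e.
  move=> c_cs; apply/mem_SEP=> x.
  have [-> | cx] := eqVneq (c x) x; first by rewrite tperm1 group1.
  have sx := (prod_disjoint x cs_dis).1 c c_cs; rewrite -sx ?inE // -s_prod.
  exact: (elimT (mem_SEP _ _)) s_SEP x.
split=> // c c_cs t _ /proper_sub/subsetP t_c; apply/mem_SEP=> x.
have [-> | tx] := eqVneq (t x) x; first by rewrite tperm1 group1.
have x_c : x \in psupp c by apply: t_c; rewrite inE.
have tx_c : t x \in psupp c by apply: t_c; rewrite inE (inj_eq perm_inj).
(* The exponent [i] depends on [x]; the criterion is applied at [x] to [c ^+ i], which agrees there
   with [t]. *)
have /porbitP[i ->] := is_cycle_transitive (cs_cycle c c_cs) x_c tx_c.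
apply: (elimT (mem_SEP _ _)); exact: groupX (cs_SEP c c_cs).
Qed.
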